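(* There are absolute constants $c_1, c_2, c_3, c_4 > 0$ (independent of $n$ and $L$) such that $$c_1 \sqrt{n(1-L)} - 1 \leq \kappa_1(n,L) \leq \mu_\infty(n,L) \leq c_2 \sqrt{n(1-L)} + 1$$ for every $n \in \mathbb{N}$ and $L \in (1/2,1]$, and $$c_3 \min\left\{\sqrt{n(-\log L)},\, n\right\} \leq \kappa_1(n,L) \leq \mu_\infty(n,L) \leq c_4 \min\left\{\sqrt{n(-\log L)},\, n\right\} + 4$$ for every $n \in \mathbb{N}$ and $L \in (0,1/2]$. Furthermore, $\kappa_1(n,L) = \mu_\infty(n,L) = 0$ for every $n \in \mathbb{N}$ and $L > 1$. Here $c_1 = 1/5$, $c_2 = 1$, $c_3 = 2/7$, and $c_4 = 13$ are appropriate choices.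
   Context: $\mathbb{N} = \{1,2,3,\ldots\}$ and $\log$ is the natural logarithm. For $n \in \mathbb{N}$ and $L > 0$, $\kappa_1(n,L)$ is the largest integer $k \geq 0$ for which there is a polynomial $P \neq 0$ of the form $$P(x) = \sum_{j=0}^n a_j x^j, \qquad |a_0| \geq L \sum_{j=1}^n |a_j|, \qquad a_j \in \mathbb{C},$$ such that $(x-1)^k$ divides $P(x)$. For $n \in \mathbb{N}$ and $L > 0$, $\mu_\infty(n,L)$ is the smallest integer $k \geq 0$ for which there is a polynomial $Q$ of degree $k$ with complex coefficients such that $$|Q(0)| > \frac{1}{L} \max_{j \in \{1,2,\ldots,n\}} |Q(j)|.$$ *)

(* Defs.v *)
From HB Require Import structures.
From mathcomp Require Import all_boot all_order all_algebra.
From mathcomp Require Import complex.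
From mathcomp Require Import boolp reals exp.
Set Implicit Arguments.
Unset Strict Implicit.
Unset Printing Implicit Defensive.
Import Order.TTheory GRing.Theory Num.Theory.
Local Open Scope ring_scope.
Local Open Scope complex_scope.

(* The real-valued modulus; the canonical norm of R[i] takes its values in
   R[i] itself. *)
Notation cabs := ComplexField.Normc.normc.

Definition kappa1_adm (R : realType) (n : nat) (L : R) (k : nat) : Prop :=
  exists P : {poly R[i]},
    [/\ P != 0, (size P <= n.+1)%N,
        L * (\sum_(1 <= j < n.+1) cabs P`_j) <= cabs P`_0
      & ('X - 1%:P) ^+ k %| P].

(* The moduli are nonnegative, so for 0 < n the initial value 0 does not affect
   the maximum. *)
Definition muoo_adm (R : realType) (n : nat) (L : R) (k : nat) : Prop :=
  exists Q : {poly R[i]},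
    size Q = k.+1 /\
    L^-1 * (\big[Num.max/0]_(1 <= j < n.+1) cabs Q.[j%:R]) < cabs Q.[0].

Lemma kappa1_adm_ex (R : realType) (n : nat) (L : R) :
  exists k, `[< kappa1_adm n L k >].
Proof.
exists 0%N; apply/asboolP; exists 1; split.
- exact: oner_neq0.
- by rewrite size_poly1.
- rewrite big_nat big1 => [|j /andP[j0 _]].
    by rewrite mulr0 coef1 ComplexField.Normc.normc1 ler01.
  by rewrite coef1 gtn_eqF// ComplexField.Normc.normc0.
- by rewrite expr0 dvd1p.
Qed.

Lemma kappa1_adm_le (R : realType) (n : nat) (L : R) (k : nat) :
  `[< kappa1_adm n L k >] -> (k <= n)%N.
Proof.
move=> /asboolP[P [P0 sP _ dvdP]].
have := dvdp_leq P0 dvdP.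
by rewrite size_exp_XsubC => /leq_trans/(_ sP).
Qed.

Lemma muoo_adm_ex (R : realType) (n : nat) (L : R) :
  exists k, `[< muoo_adm n L k >].
Proof.
pose Q : {poly R[i]} := \prod_(j <- index_iota 1 n.+1) ('X - (j%:R)%:P).
exists n; apply/asboolP; exists Q; split.
  by rewrite size_prod_XsubC size_iota subn1.
have rQ j : root Q j%:R = (1 <= j < n.+1)%N.
  rewrite -mem_index_iota -[RHS](mem_map (@mulrIn R[i] _ (oner_neq0 _))).
  by rewrite -root_prod_XsubC big_map.
have -> : \big[Num.max/0]_(1 <= j < n.+1) cabs Q.[j%:R] = 0.
  rewrite big_nat; elim/big_ind : _ => // [x y -> ->|j jn].
    by rewrite maxxx.
  by move: jn; rewrite -rQ => /rootP ->; rewrite ComplexField.Normc.normc0.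
rewrite mulr0 lt_neqAle eq_sym; apply/andP; split.
  apply/negP => /eqP/ComplexField.Normc.eq0_normc/rootP.
  by rewrite -[0]/(0%:R) rQ.
by case: Q.[0] => a b; exact: sqrtr_ge0.
Qed.

Definition kappa1 (R : realType) (n : nat) (L : R) : nat :=
  ex_maxn (kappa1_adm_ex n L) (@kappa1_adm_le R n L).

Definition muoo (R : realType) (n : nat) (L : R) : nat :=
  ex_minn (muoo_adm_ex n L).

(* Main.v *)
Require Import Defs.
From mathcomp Require Import all_boot all_order all_algebra.
From mathcomp Require Import complex.
From mathcomp Require Import boolp reals exp.
From mathcomp Require Import ring lra zify qpoly.
From mathcomp Require Import topology normedtype derive trigo.
Set Implicit Arguments.
Unset Strict Implicit.
Unset Printing Implicit Defensive.
Import Order.TTheory GRing.Theory Num.Theory.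
Import numFieldNormedType.Exports.
Local Open Scope ring_scope.

(** A polynomial P vanishes to order k at 1 exactly when the functional
    Q |-> sum_j P_j Q(j) kills all Q of degree less than k ([moment_eq0],
    [dvdp_of_moments]). If a P for kappa1 and a Q for muoo had k > deg Q, the
    relation P_0 Q(0) = - sum_(j >= 1) P_j Q(j) would contradict the
    inequalities that define them; hence kappa1 <= muoo ([kappa1_le_muoo]). What
    is left is to construct good polynomials P, for the lower bounds on kappa1,
    and good polynomials Q, for the upper bounds on muoo. Both come from
    Chebyshev polynomials on an interval of length n.

    Construction of P. The weights of Lagrange interpolation at nodes
    x_0 < ... < x_d in {1, ..., n}, evaluated at 0, give a P with P_0 = 1 that
    vanishes to order d + 1 at 1. These weights alternate in sign, so the sum of
    their moduli is at most S(0) / eta as soon as some S of degree d takes values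
    of alternating sign and modulus at least eta at the nodes
    ([vanishing_of_alternation]). For S the Chebyshev polynomial of [0, n] and
    its extreme points rounded to integers, eta = 1 - 2 d ^ 2 / n
    ([cheb_vanishing]), because cheb d is Lipschitz with constant d ^ 2 on
    [-1, 1] ([cheb_lip]). With d of order sqrt (n (1 - L)) this settles L > 1/2.
    For small L one takes a power: r factors of degree n / r and of order about
    sqrt (n / r) / 2, with 3 ^ r close to 1 / L, give order about sqrt (n r) / 2
    ([kappa1_ge_small]).

    Construction of Q. For L > 1/2 the Chebyshev polynomial itself works, since
    it is at least 1 + 2 k ^ 2 / n at distance 1 from its interval
    ([muoo_le_near1]). For small L it is modified: its first m zeros, which are
    crowded near 0, are moved to the integers 1, ..., m. The values at
    1, ..., m become 0, and at the integers beyond m each of the m moves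
    gains a factor 2 relative to the value at 0 ([muoo_le_small]). With 2 ^ m
    just above 1 / L the degree needed is of order sqrt (n m). *)

(** * Moments and the order of vanishing at 1 *)

(** The pairing through which kappa1 and muoo are dual: vanishing of P at 1 to
    order k amounts to the coefficients of P, seen as a signed measure on the
    integers, annihilating the polynomials of degree less than k. *)
Definition moment {F : fieldType} (P Q : {poly F}) : F :=
  \sum_(j < size P) P`_j * Q.[j%:R].

Lemma momentE {F : fieldType} (P Q : {poly F}) (n : nat) :
  (size P <= n)%N -> moment P Q = \sum_(j < n) P`_j * Q.[j%:R].
Proof.
move=> sP; rewrite /moment (big_ord_widen n (fun j => P`_j * Q.[j%:R])) //.
rewrite big_mkcond /=; apply: eq_bigr => j _.
by case: ltnP => // sj; rewrite nth_default ?mul0r.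
Qed.

Lemma momentZr {F : fieldType} (P Q : {poly F}) (a : F) :
  moment P (a *: Q) = a * moment P Q.
Proof.
by rewrite /moment mulr_sumr; apply: eq_bigr => j _; rewrite hornerZ mulrCA.
Qed.

Definition fdiff {F : fieldType} (Q : {poly F}) : {poly F} :=
  Q \Po ('X + 1) - Q.

(** Summation by parts: a factor 'X - 1 of P is a difference operator on Q, so
    the order of vanishing at 1 can be traded for the degree of Q. *)
Lemma moment_mulXsub1 {F : fieldType} (P Q : {poly F}) :
  moment (('X - 1%:P) * P) Q = moment P (fdiff Q).
Proof.
have sXP : (size (('X - 1%:P) * P)%R <= (size P).+1)%N.
  by rewrite (leq_trans (size_polyMleq _ _)) // size_XsubC.
rewrite (momentE _ sXP) /moment.
under eq_bigr do rewrite mulrBl polyC1 mul1r coefB coefXM mulrBl.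
rewrite sumrB big_ord_recl /= mul0r add0r.
rewrite [X in _ - X]big_ord_recr /= nth_default // mul0r addr0.
rewrite -sumrB; apply: eq_bigr => j _.
rewrite /fdiff hornerD hornerN horner_comp hornerD hornerX hornerC mulrBr.
by rewrite /bump /= add1n [in LHS]mulrS addrC.
Qed.

Lemma size_fdiff {F : fieldType} (Q : {poly F}) (k : nat) :
  (size Q <= k.+1)%N -> (size (fdiff Q) <= k)%N.
Proof.
have sX1 : size ('X + 1 : {poly F}) = 2%N by rewrite -polyC1 size_XaddC.
rewrite /fdiff leq_eqVlt => /orP[/eqP sQ|sQ]; last first.
  by rewrite (leq_trans (size_polyD _ _)) // size_polyN size_comp_poly2 // maxnn.
apply/leq_sizeP => i; rewrite leq_eqVlt => /orP[/eqP <-|ki]; last first.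
  by rewrite coefB !nth_default ?subrr ?size_comp_poly2 ?sQ.
have lead (p : {poly F}) : size p = k.+1 -> p`_k = lead_coef p.
  by rewrite lead_coefE => ->.
rewrite coefB !lead ?size_comp_poly2 //.
by rewrite lead_coef_comp ?sX1 // -polyC1 lead_coefXaddC expr1n mulr1 subrr.
Qed.

(** Each factor 'X - 1 lowers the degree of Q by one, until Q is exhausted. *)
Lemma moment_eq0 {F : fieldType} (P Q : {poly F}) (k : nat) :
  ('X - 1%:P) ^+ k %| P -> (size Q <= k)%N -> moment P Q = 0.
Proof.
case/dvdpP => H ->; rewrite mulrC.
elim: k Q => [|k IHk] Q; last first.
  by move=> /size_fdiff/IHk; rewrite exprS -mulrA moment_mulXsub1.
rewrite leqn0 size_poly_eq0 => /eqP->; rewrite /moment big1 // => j _.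
by rewrite horner0 mulr0.
Qed.

Definition falling_poly {F : fieldType} (i : nat) : {poly F} :=
  \prod_(l < i) ('X - (l%:R)%:P).

Lemma size_falling_poly {F : fieldType} (i : nat) :
  size (falling_poly i : {poly F}) = i.+1.
Proof. by rewrite /falling_poly size_prod_XsubC /index_enum -enumT size_enum_ord. Qed.

(** The falling factorials behave under differences as monomials do under
    derivation; they provide the antidifferences needed for the converse
    of [moment_eq0]. *)
Lemma fdiff_falling_poly {F : fieldType} (i : nat) :
  fdiff (falling_poly i.+1) = i.+1%:R *: falling_poly i :> {poly F}.
Proof.
have shift : falling_poly i.+1 \Po ('X + 1) = ('X + 1) * falling_poly i :> {poly F}.
  elim: i => [|i IHi].
    by rewrite /falling_poly big_ord_recr !big_ord0 /= subr0 mul1r comp_polyX mulr1.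
  rewrite {1}/falling_poly big_ord_recr -/(falling_poly _) comp_polyM IHi /=.
  rewrite comp_polyB comp_polyX comp_polyC -mulrA [in RHS]/falling_poly big_ord_recr /=.
  by congr (_ * (_ * _)); rewrite -natr1 polyCD polyC1; ring.
rewrite /fdiff shift {1 2}/falling_poly big_ord_recr /= -/(falling_poly _) -mul_polyC.
by rewrite -natr1 polyCD polyC1; ring.
Qed.

(** Converse of [moment_eq0], tested on a basis. The 0th moment is P(1); after
    dividing P by 'X - 1, the moments of the quotient are, up to the nonzero
    factors i + 1, the later moments of P. *)
Lemma dvdp_of_moments {F : fieldType} (P : {poly F}) (k : nat) :
  (forall i, (i.+1)%:R != 0 :> F) ->
  (forall i, (i < k)%N -> moment P (falling_poly i) = 0) ->
  ('X - 1%:P) ^+ k %| P.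
Proof.
move=> char0; elim: k P => [|k IHk] P mom0; first by rewrite expr0 dvd1p.
have /factor_theorem[H defP] : root P 1.
  apply/rootP; rewrite -[RHS](mom0 0%N) // horner_coef /moment.
  by apply: eq_bigr => j _; rewrite /falling_poly big_ord0 hornerC expr1n.
rewrite defP exprSr dvdp_mul2r ?polyXsubC_eq0 // IHk // => i ik.
apply: (mulfI (char0 i)); rewrite mulr0 -momentZr -fdiff_falling_poly.
by rewrite -moment_mulXsub1 mulrC -defP mom0.
Qed.

(** * Chebyshev polynomials *)

Fixpoint cheb {R : realType} (d : nat) : {poly R} :=
  match d with
  | 0 => 1
  | d'.+1 => if d' is d''.+1 then 2 *: 'X * cheb d' - cheb d'' else 'X
  end.

Lemma chebSS {R : realType} (d : nat) :
  cheb d.+2 = 2 *: 'X * cheb d.+1 - cheb d :> {poly R}.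
Proof. by []. Qed.

Lemma cheb_cos {R : realType} (d : nat) (t : R) :
  (cheb d).[cos t] = cos (d%:R * t).
Proof.
suff: (cheb d).[cos t] = cos (d%:R * t) /\
      (cheb d.+1).[cos t] = cos (d.+1%:R * t) by case.
elim: d => [|d [IH0 IH1]]; first by rewrite /= hornerC hornerX mul0r cos0 mul1r.
split=> //; rewrite chebSS hornerD hornerN hornerM hornerZ hornerX IH0 IH1.
have -> : d.+2%:R * t = d.+1%:R * t + t by rewrite -natr1; ring.
have -> : d%:R * t = d.+1%:R * t - t by rewrite -natr1; ring.
by rewrite cosB cosD; ring.
Qed.

Lemma size_cheb {R : realType} (d : nat) : size (cheb d : {poly R}) = d.+1.
Proof.
suff: size (cheb d : {poly R}) = d.+1 /\ size (cheb d.+1 : {poly R}) = d.+2 by case.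
elim: d => [|d [IH0 IH1]]; first by rewrite size_poly1 size_polyX.
have s2X : size (2 *: 'X * cheb d.+1 : {poly R}) = d.+3.
  rewrite -scalerAl size_scale ?pnatr_eq0 // mulrC size_mulX ?IH1 //.
  by rewrite -size_poly_eq0 IH1.
by split=> //; rewrite chebSS size_polyDl // size_polyN s2X IH0.
Qed.

Lemma cheb_le1 {R : realType} (d : nat) (y : R) :
  -1 <= y <= 1 -> `|(cheb d).[y]| <= 1.
Proof. by move=> y1; rewrite -(acosK (x := y)) ?cheb_cos ?cos_max // in_itv. Qed.

(** Past 1 the increments cheb (d + 1) - cheb d grow by at least 2 (y - 1) at
    each step, because cheb d >= 1 there; summing them gives the d ^ 2. *)
Lemma cheb_ge {R : realType} (d : nat) (y : R) :
  1 <= y -> 1 + d%:R ^+ 2 * (y - 1) <= (cheb d).[y].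
Proof.
move=> y1; suff: 1 + d%:R ^+ 2 * (y - 1) <= (cheb d).[y] /\
  (d%:R *+ 2 + 1) * (y - 1) <= (cheb d.+1).[y] - (cheb d).[y] by case.
elim: d => [|d [IH0 IH1]].
  by rewrite /= hornerC hornerX; split; nra.
have IH2 : 1 + d.+1%:R ^+ 2 * (y - 1) <= (cheb d.+1).[y].
  by rewrite -natr1; move: IH0 IH1; nra.
split=> //; rewrite chebSS hornerD hornerN hornerM hornerZ hornerX.
have T1 : 1 <= (cheb d.+1).[y].
  by apply: le_trans IH2; rewrite lerDl mulr_ge0 ?sqr_ge0 ?subr_ge0.
have -> : 2 * y * (cheb d.+1).[y] - (cheb d).[y] - (cheb d.+1).[y] =
  (y - 1) * 2 * (cheb d.+1).[y] + ((cheb d.+1).[y] - (cheb d).[y]) by ring.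
have : 2 * (y - 1) <= (y - 1) * 2 * (cheb d.+1).[y].
  by rewrite mulrC ler_peMr // mulr_ge0 ?subr_ge0.
by rewrite -natr1; move: IH1; lra.
Qed.

(** Source of the Lipschitz constant d ^ 2 of cheb d, which is thus obtained
    without derivatives of polynomials. *)
Lemma sin_mulnr_le {R : realType} (d : nat) (t : R) :
  `|sin (d%:R * t)| <= d%:R * `|sin t|.
Proof.
elim: d => [|d IHd]; first by rewrite !mul0r sin0 normr0.
rewrite -natr1 !mulrDl !mul1r sinD (le_trans (ler_normD _ _)) // !normrM.
apply: lerD; first by rewrite (le_trans _ IHd) // ler_piMr // cos_max.
by rewrite ler_piMl // cos_max.
Qed.

Lemma cosB_sin {R : realType} (s t : R) :
  cos s - cos t = - (2 * sin ((s + t) / 2) * sin ((s - t) / 2)).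
Proof.
have Es : s = (s + t) / 2 + (s - t) / 2 by field.
have Et : t = (s + t) / 2 - (s - t) / 2 by field.
rewrite [X in cos X - _]Es [X in _ - cos X]Et.
by rewrite cosB cosD; ring.
Qed.

(** With x = cos s and y = cos t, both differences of cosines factor into sines
    of half sums and half differences, and each of the two sines loses a
    factor d. *)
Lemma cheb_lip {R : realType} (d : nat) (x y : R) :
  -1 <= x <= 1 -> -1 <= y <= 1 ->
  `|(cheb d).[x] - (cheb d).[y]| <= d%:R ^+ 2 * `|x - y|.
Proof.
move=> x1 y1; rewrite -(acosK (x := x)) ?in_itv // -(acosK (x := y)) ?in_itv //.
set s := acos x; set t := acos y; rewrite !cheb_cos !cosB_sin !normrN !normrM.
rewrite -mulrDr -mulrBr -!(mulrA d%:R) !normr_nat.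
have -> : forall a b c : R, a * (a * (2 * b * c)) = 2 * (a * b) * (a * c).
  by move=> a b c; ring.
by rewrite ler_pM ?mulr_ge0 // ?ler_wpM2l // sin_mulnr_le.
Qed.

Lemma sin_le_id {R : realType} (x : R) : 0 <= x -> `|sin x| <= x.
Proof.
move=> x0; have dsin (z : R) : z \in `]0, x[%R -> is_derive z (1 : R) (@sin R) (cos z).
  by move=> _; exact: is_derive_sin.
have [|c _] := MVT_segment x0 dsin.
  exact/continuous_subspaceT/continuous_sin.
rewrite sin0 !subr0 => ->; rewrite normrM (ger0_norm x0) ler_piMl //.
exact: cos_max.
Qed.

Lemma one_sub_cos_le {R : realType} (x : R) : 0 <= x -> 1 - cos x <= x ^+ 2 / 2.
Proof.
move=> x0; rewrite -[X in X - _]cos0 cosB_sin add0r sub0r mulNr sinN mulrN opprK.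
have /sin_le_id h : 0 <= x / 2 by lra.
rewrite -mulrA -expr2 -[sin _ ^+ 2]real_normK ?num_real //.
have -> : x ^+ 2 / 2 = 2 * (x / 2) ^+ 2 by field.
by rewrite ler_pM2l ?ltr0n // ler_pXn2r // nnegrE //; lra.
Qed.

(** * The sum of the moduli of the coefficients *)

Definition l1norm {R : realType} (P : {poly R}) : R := \sum_(j < size P) `|P`_j|.

Lemma l1normE {R : realType} (P : {poly R}) (n : nat) :
  (size P <= n)%N -> l1norm P = \sum_(j < n) `|P`_j|.
Proof.
move=> sP; rewrite /l1norm (big_ord_widen n (fun j => `|P`_j|)) //.
rewrite big_mkcond /=; apply: eq_bigr => j _.
by case: ltnP => // sj; rewrite nth_default ?normr0.
Qed.

Lemma l1normZ {R : realType} (c : R) (P : {poly R}) :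
  l1norm (c *: P) = `|c| * l1norm P.
Proof.
rewrite (l1normE (size_scale_leq c P)) /l1norm mulr_sumr.
by apply: eq_bigr => j _; rewrite coefZ normrM.
Qed.

Lemma l1normD {R : realType} (P Q : {poly R}) :
  l1norm (P + Q) <= l1norm P + l1norm Q.
Proof.
rewrite (l1normE (size_polyD P Q)) (l1normE (leq_maxl (size P) (size Q))).
rewrite (l1normE (leq_maxr (size P) (size Q))) -big_split /=.
by apply: ler_sum => j _; rewrite coefD ler_normD.
Qed.

Lemma l1norm_sum {R : realType} (I : Type) (r : seq I) (F : I -> {poly R}) :
  l1norm (\sum_(i <- r) F i) <= \sum_(i <- r) l1norm (F i).
Proof.
elim/big_rec2: _ => [|i y Q _ IH]; first by rewrite /l1norm size_poly0 big_ord0.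
by rewrite (le_trans (l1normD _ _)) // lerD2l.
Qed.

Lemma l1norm_Xn {R : realType} (n : nat) : l1norm ('X^n : {poly R}) = 1.
Proof.
rewrite /l1norm size_polyXn big_ord_recr /= big1 => [|j _].
  by rewrite coefXn eqxx normr1 add0r.
by rewrite coefXn (ltn_eqF (ltn_ord j)) normr0.
Qed.

Lemma l1norm1 {R : realType} : l1norm (1 : {poly R}) = 1.
Proof. exact: (l1norm_Xn 0). Qed.

Lemma l1norm_MXaddC {R : realType} (P : {poly R}) (c : R) :
  l1norm (P * 'X + c%:P) = l1norm P + `|c|.
Proof.
have sPXc : (size (P * 'X + c%:P)%R <= (size P).+1)%N.
  by rewrite size_MXaddC; case: ifP.
rewrite (l1normE sPXc) big_ord_recl coefD coefMX coefC /= add0r addrC.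
by congr (_ + _); apply: eq_bigr => j _; rewrite coefD coefMX coefC /= addr0.
Qed.

Lemma l1normM {R : realType} (P Q : {poly R}) :
  l1norm (P * Q) <= l1norm P * l1norm Q.
Proof.
elim/poly_ind: P => [|P c IHP].
  by rewrite mul0r /l1norm size_poly0 big_ord0 mul0r.
have -> : (P * 'X + c%:P) * Q = (P * Q * 'X + 0%:P) + c *: Q.
  by rewrite -mul_polyC polyC0; ring.
rewrite (le_trans (l1normD _ _)) // !l1norm_MXaddC normr0 addr0 l1normZ mulrDl.
by rewrite lerD2r.
Qed.

Lemma l1normX {R : realType} (P : {poly R}) (r : nat) :
  l1norm (P ^+ r) <= l1norm P ^+ r.
Proof.
elim: r => [|r IHr]; first by rewrite !expr0 l1norm1.
rewrite !exprS (le_trans (l1normM _ _)) // ler_wpM2l //.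
exact: sumr_ge0.
Qed.

(** * Polynomials with small coefficients vanishing to high order at 1 *)

(** At 0 the i-th Lagrange polynomial is the product over j != i of the factors
    - y_j / (y_i - y_j), which are nonpositive for the i indices j < i and
    nonnegative for j > i. *)
Lemma lagrange_at0_sign {R : realType} (d : nat) (y : nat -> nat)
    (y_lt : {homo y : i j / (i < j)%N})
    (inj_y : injective (fun i => (y i)%:R : R)) (i : 'I_d.+1) :
  0 <= (-1) ^+ i * (tnth (lagrange d.+1 (fun i => (y i)%:R : R)) i : {poly R}).[0].
Proof.
rewrite lagrangeE // hornerM hornerC !horner_prod.
have -> : (-1) ^+ i = \prod_(j < d.+1 | j != i) (-1) ^+ (j < i)%N :> R.
  rewrite prodrXr; congr (_ ^+ _).
  rewrite big_mkcond (bigD1 i) //= eqxx add0n.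
  rewrite [RHS](eq_bigr (fun j : 'I_d.+1 => if (j < i)%N then 1%N else 0%N));
    last by move=> j ->; case: (j < i)%N.
  rewrite -big_mkcondr /= -[LHS]card_ord -sum1_card.
  rewrite (big_ord_widen d.+1 (fun=> 1%N) (ltnW (ltn_ord i))).
  by apply: eq_bigl => j; rewrite -val_eqE /= andb_idl // => /ltn_eqF ->.
rewrite -prodfV -!big_split /= prodr_ge0 // => j ji.
rewrite !hornerXsubC sub0r mulrCA.
case: (ltngtP j i) ji => [ji _|ij _|/val_inj->]; last by rewrite eqxx.
  by rewrite expr1 mulN1r opprK mulr_ge0 // invr_ge0 subr_ge0 ler_nat ltnW ?y_lt.
rewrite expr0 mul1r mulrN -mulNr mulr_ge0 // oppr_ge0 invr_le0 subr_le0 ler_nat.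
by rewrite ltnW ?y_lt.
Qed.

(** Lagrange interpolation at the nodes x_0 < ... < x_d expresses Q(0) by the
    values Q(x_i), for every Q of degree at most d; the polynomial
    P = 1 - sum_i w_i 'X^(x_i) built on its weights thus vanishes to order
    d + 1 at 1. The weights alternate in sign, so a polynomial S that also
    alternates at the nodes detects the sum of their moduli: it is at most
    sum_i w_i S(x_i) / eta = S(0) / eta. The sign changes of S also separate the
    nodes, so that rounding, which is only weakly monotone, can supply them. *)
Lemma vanishing_of_alternation {R : realType} (n d : nat) (x : nat -> nat)
    (S : {poly R}) (eta : R) :
  0 < eta -> (size S <= d.+1)%N ->
  (forall i, (i <= d)%N -> (1 <= x i <= n)%N) ->
  (forall i, (i < d)%N -> (x i <= x i.+1)%N) ->
  (forall i, (i <= d)%N -> eta <= (-1) ^+ i * S.[(x i)%:R]) ->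
  exists P : {poly R}, [/\ P`_0 = 1, (size P <= n.+1)%N,
    ('X - 1%:P) ^+ d.+1 %| P & l1norm P <= 1 + S.[0] / eta].
Proof.
move=> eta0 sS xn x_le alt.
have x_lt i : (i < d)%N -> (x i < x i.+1)%N.
  move=> id; rewrite ltn_neqAle x_le // andbT; apply/eqP => exi.
  have := alt _ (ltnW id); have := alt i.+1 id.
  by rewrite -exi exprS mulN1r mulNr; move: eta0; lra.
(* Nodes are indexed by all of nat: continue x injectively beyond d. *)
pose y i := if (i <= d)%N then x i else (n + i)%N.
have y_lt : {homo y : i j / (i < j)%N}.
  apply: homo_ltn => [a b c|i]; first exact: ltn_trans.
  rewrite /y; case: (ltngtP i d) => [id|di|->]; first exact: x_lt.
    by rewrite addnS ltnS.
  have /andP[_ /leq_ltn_trans->] := xn d (leqnn d); rewrite ?ltnn //.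
  by rewrite addnS ltnS leq_addr.
have yE (i : 'I_d.+1) : y i = x i by rewrite /y -ltnS ltn_ord.
have inj_y : injective (fun i => (y i)%:R : R).
  move=> i j /eqP; rewrite eqr_nat => /eqP yij.
  by case: (ltngtP i j) => // /y_lt; rewrite yij ltnn.
pose w (i : 'I_d.+1) :=
  (tnth (lagrange d.+1 (fun i => (y i)%:R : R)) i : {poly R}).[0].
have interp (Q : {poly R}) : (size Q <= d.+1)%N ->
    Q.[0] = \sum_(i < d.+1) Q.[(x i)%:R] * w i.
  move=> sQ; rewrite [in LHS](lagrange_gen (ltn0Sn d) inj_y sQ) horner_sum.
  by apply: eq_bigr => i _; rewrite hornerM hornerC yE.
pose P : {poly R} := 1 - \sum_(i < d.+1) w i *: 'X^(x i).
have coefP j : P`_j = (j == 0)%:R - \sum_(i < d.+1) w i * (j == x i)%:R.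
  rewrite /P coefB coef1 coef_sum; congr (_ - _).
  by apply: eq_bigr => i _; rewrite coefZ coefXn.
have sP : (size P <= n.+1)%N.
  rewrite (leq_trans (size_polyD _ _)) // geq_max size_poly1 size_polyN ltnS /=.
  rewrite (leq_trans (size_sum _ _ _)) //; apply/bigmax_leqP => i _.
  rewrite (leq_trans (size_scale_leq _ _)) // size_polyXn ltnS.
  by have /andP[] := xn i (ltn_ord i).
exists P; split=> //.
- rewrite coefP big1 ?subr0 // => i _; rewrite eq_sym gtn_eqF ?mulr0 //.
  by have /andP[] := xn i (ltn_ord i).
- apply: dvdp_of_moments => [i|i id]; first by rewrite pnatr_eq0.
  have sF : (size (falling_poly i : {poly R}) <= d.+1)%N by rewrite size_falling_poly.
  rewrite (momentE _ sP).
  under eq_bigr do rewrite coefP mulrBl mulr_suml.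
  rewrite sumrB exchange_big /= big_ord_recl big1 => [|j _]; last by rewrite mul0r.
  rewrite mul1r addr0 (interp _ sF); apply/eqP; rewrite subr_eq0; apply/eqP.
  apply: eq_bigr => l _.
  have xl : (x l < n.+1)%N by rewrite ltnS; have /andP[] := xn l (ltn_ord l).
  rewrite (bigD1 (Ordinal xl)) //= eqxx mulr1 mulrC big1 ?addr0 // => j.
  by rewrite -val_eqE /= => /negPf->; rewrite mulr0 mul0r.
- have wE (i : 'I_d.+1) : `|w i| = (-1) ^+ i * w i.
    rewrite -[RHS]ger0_norm; last exact: lagrange_at0_sign y_lt inj_y i.
    by rewrite normrM normr_sign mul1r.
  rewrite (le_trans (l1normD _ _)) // l1norm1 lerD2l -scaleN1r l1normZ normrN1 mul1r.
  rewrite (le_trans (l1norm_sum _ _)) // interp // mulr_suml; apply: ler_sum => i _.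
  rewrite l1normZ l1norm_Xn mulr1 ler_pdivlMr //.
  have -> : S.[(x i)%:R] * w i = `|w i| * ((-1) ^+ i * S.[(x i)%:R]).
    by rewrite wE mulrACA -expr2 sqrr_sign mul1r mulrC.
  by rewrite ler_wpM2l // alt // -ltnS.
Qed.

(** The extremal choice would be the extreme points u_i of the Chebyshev
    polynomial of [0, n]. They are rounded to integers in [1, n], which moves
    them by at most 1; by the Lipschitz bound the values +-1 of the polynomial
    then deteriorate by at most 2 d ^ 2 / n, while its value at 0 is 1. *)
Lemma cheb_vanishing {R : realType} (n d : nat) :
  (0 < n)%N -> (2 * d ^ 2 < n)%N ->
  exists P : {poly R}, [/\ P`_0 = 1, (size P <= n.+1)%N,
    ('X - 1%:P) ^+ d.+1 %| P & l1norm P <= 1 + (1 - 2 * d%:R ^+ 2 / n%:R)^-1].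
Proof.
move=> n0 dn; have nR0 : 0 < n%:R :> R by rewrite ltr0n.
pose c (i : nat) : R := cos (i%:R / d%:R * pi).
pose u i : R := n%:R * (1 - c i) / 2.
have c1 i : -1 <= c i <= 1 by rewrite /c cos_geN1 cos_le1.
have u0 i : 0 <= u i by have := c1 i; rewrite /u; nra.
have un i : u i <= n%:R by have := c1 i; rewrite /u; nra.
pose x i := minn n (Num.truncn (u i)).+1.
pose S : {poly R} := cheb d \Po (1 - (2 / n%:R) *: 'X).
have SE t : S.[t] = (cheb d).[1 - 2 / n%:R * t].
  by rewrite horner_comp hornerD hornerN hornerZ hornerX hornerC.
have sub_u i : `|(x i)%:R - u i| <= 1.
  have /andP[tu ut] := truncn_itv (u0 i); rewrite /x ler_distl.
  have := un i; rewrite /minn; case: ltnP => [h|_]; last first.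
    by move: ut; rewrite -natr1; lra.
  have : (n%:R : R) <= (Num.truncn (u i))%:R + 1 by rewrite natr1 ler_nat ltnW.
  by lra.
have xn i : (1 <= x i <= n)%N by rewrite /x leq_min n0 ltnS leq0n geq_minl.
have eta0 : 0 < 1 - 2 * d%:R ^+ 2 / n%:R :> R.
  by rewrite subr_gt0 ltr_pdivrMr // mul1r -natrX -natrM ltr_nat.
have [||||P] := vanishing_of_alternation (n := n) (x := x) (d := d) (S := S) eta0.
- rewrite (leq_trans (size_comp_poly_leq _ _)) // size_cheb /= ltnS.
  rewrite -[leqRHS]muln1 leq_mul2l -subn1 leq_subLR.
  rewrite (leq_trans (size_polyD _ _)) ?orbT //.
  rewrite geq_max size_poly1 size_polyN (leq_trans (size_scale_leq _ _)) ?orbT //.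
  by rewrite size_polyX.
- by [].
- move=> i id; have d0 : 0 < d%:R :> R by rewrite ltr0n (leq_trans _ id).
  have c_le : c i.+1 <= c i.
    have in0pi j : (j <= d)%N -> (j%:R / d%:R * pi : R) \in `[0, pi]%R.
      move=> jd; rewrite in_itv /= mulr_ge0 ?pi_ge0 ?divr_ge0 //=.
      by rewrite ler_piMl ?pi_ge0 // ler_pdivrMr // mul1r ler_nat.
    rewrite leNgt (ltr_cos (in0pi i.+1 id) (in0pi i (ltnW id))) -leNgt.
    by rewrite ler_pM2r ?pi_gt0 // ler_pM2r ?invr_gt0 // ler_nat.
  have : u i <= u i.+1 by rewrite /u; nra.
  by move=> /le_truncn ui; rewrite /x; lia.
- move=> i id; set t : R := 1 - 2 / n%:R * (x i)%:R.
  have tE : t - c i = - (2 / n%:R) * ((x i)%:R - u i).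
    by rewrite /t /u; field; rewrite gt_eqF.
  have t1 : -1 <= t <= 1.
    have /andP[x1 xn1] := xn i.
    have xnR : ((x i)%:R : R) <= n%:R by rewrite ler_nat.
    have -> : t = 1 - 2 * ((x i)%:R / n%:R) by rewrite /t; ring.
    have : 0 <= (x i)%:R / n%:R :> R by rewrite divr_ge0.
    have : (x i)%:R / n%:R <= 1 :> R by rewrite ler_pdivrMr // mul1r.
    by lra.
  have Tc : (cheb d).[c i] = (-1) ^+ i.
    rewrite cheb_cos; case: (posnP d) id => [-> |d0 _].
      by rewrite leqn0 mul0r cos0 => /eqP->.
    rewrite mulrA mulrCA divff ?pnatr_eq0 -?lt0n // mulr1.
    elim: (i) => [|j IHj]; first by rewrite mul0r cos0.
    by rewrite -natr1 mulrDl mul1r cosDpi IHj exprS mulN1r.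
  have := cheb_lip d t1 (c1 i); rewrite Tc tE normrM normrN.
  rewrite (ger0_norm (x := 2 / n%:R)) ?divr_ge0 // => lip.
  have {lip} : `|(cheb d).[t] - (-1) ^+ i| <= 2 * d%:R ^+ 2 / n%:R.
    have -> : 2 * d%:R ^+ 2 / n%:R = d%:R ^+ 2 * (2 / n%:R * 1) :> R by ring.
    by rewrite (le_trans lip) // ler_wpM2l ?sqr_ge0 // ler_wpM2l // divr_ge0.
  rewrite SE -/t -signr_odd; case: (odd i); rewrite ?expr1 ?expr0 ler_distl => /andP[].
    by lra.
  by lra.
rewrite SE mulr0 subr0 => -[P1 P2 P3 P4]; exists P; split=> //.
move: P4; suff -> : (cheb d).[1] = 1 :> R by rewrite div1r.
by rewrite -cos0 cheb_cos mulr0.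
Qed.

(** * Comparing kappa1 and muoo *)

Lemma cabs_real {R : realType} (a : R) : cabs (real_complex R a) = `|a|.
Proof. by rewrite /= expr0n /= addr0 sqrtr_sqr. Qed.

Lemma kappa1_ge {R : realType} (n : nat) (L : R) (k : nat) (P : {poly R}) :
  0 < L -> P`_0 = 1 -> (size P <= n.+1)%N -> ('X - 1%:P) ^+ k %| P ->
  l1norm P <= 1 + L^-1 -> (k <= kappa1 n L)%N.
Proof.
move=> L0 P0 sP dvdP lP; rewrite /kappa1; case: ex_maxnP => m _; apply.
apply/asboolP; pose PC := map_poly (real_complex R) P.
exists PC; split.
- by rewrite map_poly_eq0; apply: contra_eq_neq P0 => ->; rewrite coef0 eq_sym oner_eq0.
- by rewrite size_map_poly.
- rewrite !coef_map cabs_real P0 normr1.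
  move: lP; rewrite (l1normE sP) big_ord_recl P0 normr1 lerD2l -[L^-1]mulr1.
  rewrite ler_pdivlMl //; apply: le_trans; rewrite ler_pM2l //.
  rewrite big_add1 big_mkord; apply: ler_sum => j _.
  by rewrite coef_map cabs_real.
- by rewrite -(rmorph1 (real_complex R)) -map_polyXsubC -rmorphXn dvdp_map.
Qed.

(** If P vanishes at 1 to an order exceeding the degree of Q, then
    P_0 Q(0) = - sum_j P_j Q(j), so |P_0| |Q(0)| is at most the maximum of
    |Q(j)| times the sum of |P_j|, which contradicts the two defining
    inequalities together. *)
Lemma kappa1_le_muoo {R : realType} (n : nat) (L : R) :
  0 < L -> (kappa1 n L <= muoo n L)%N.
Proof.
move=> L0; rewrite /kappa1; case: ex_maxnP => k /asboolP[P [P0 sP lP dvdP]] _.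
rewrite /muoo; case: ex_minnP => m /asboolP[Q [sQ maxQ]] _.
rewrite leqNgt; apply/negP => mk.
have := moment_eq0 dvdP (Q := Q); rewrite sQ => /(_ mk).
rewrite (momentE _ sP) big_ord_recl => /eqP; rewrite addr_eq0 => /eqP /(congr1 (@cabs R)).
rewrite ComplexField.Normc.normcM normcN /=.
set M := \big[Num.max/0]_(1 <= j < n.+1) _ in maxQ.
set A := \sum_(1 <= j < n.+1) _ in lP.
have cabs_ge0 z : 0 <= cabs z :> R by case: z => a b; exact: sqrtr_ge0.
have A0 : 0 <= A by rewrite /A sumr_ge0.
have P00 : 0 < cabs P`_0.
  rewrite lt_neqAle cabs_ge0 andbT eq_sym; apply/eqP => z0.
  have A_eq0 : A = 0.
    by apply/eqP; rewrite eq_le A0 andbT -(ler_pM2l L0) mulr0 -z0.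
  case/eqP: P0; apply/polyP => j; rewrite coef0.
  case: (posnP j) => [->|j0]; first exact/ComplexField.Normc.eq0_normc.
  case: (ltnP j n.+1) => [jn|nj]; last by rewrite nth_default // (leq_trans sP).
  move/eqP: A_eq0; rewrite /A big_nat psumr_eq0 => [|i _]; last exact: cabs_ge0.
  move=> /allP/(_ j); rewrite mem_index_iota j0 jn => /(_ isT)/implyP/(_ isT)/eqP.
  exact: ComplexField.Normc.eq0_normc.
move=> E; suff : cabs P`_0 * cabs Q.[0] <= A * M.
  apply/negP; rewrite -ltNge (le_lt_trans _ (_ : cabs P`_0 * (L^-1 * M) < _)) //.
    rewrite mulrA ler_wpM2r ?ler_pdivlMr // 1?mulrC //.
    by rewrite /M big_nat; elim/big_ind: _ => // a b a0 b0; rewrite le_max a0.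
  by rewrite ltr_pM2l.
rewrite E /A big_add1 big_mkord mulr_suml.
have cabs_sum (I : Type) (r : seq I) (F : I -> R[i]) :
  cabs (\sum_(i <- r) F i) <= \sum_(i <- r) cabs (F i).
  elim/big_rec2: _ => [|i y z _ IH]; first by rewrite ComplexField.Normc.normc0.
  by rewrite (le_trans (le_normcD _ _)) // lerD2l.
rewrite (le_trans (cabs_sum _ _ _)) //; apply: ler_sum => j _.
rewrite ComplexField.Normc.normcM ler_wpM2l //.
apply: (le_bigmax_seq _ j.+1 xpredT (fun j => cabs Q.[j%:R])) => //.
by rewrite mem_index_iota /= ltnS ltn_ord.
Qed.

(** * Lower bounds for kappa1 *)

Lemma kappa1_ge_near1 {R : realType} (n d : nat) (L : R) :
  (0 < n)%N -> 0 < L -> L <= 1 - 2 * d%:R ^+ 2 / n%:R -> (d.+1 <= kappa1 n L)%N.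
Proof.
move=> n0 L0 dL; have nR0 : 0 < n%:R :> R by rewrite ltr0n.
have dn : (2 * d ^ 2 < n)%N.
  rewrite -(ltr_nat R) natrM natrX.
  by have := lt_le_trans L0 dL; rewrite subr_gt0 ltr_pdivrMr // mul1r.
have [P [P0 sP dvdP lP]] := @cheb_vanishing R n d n0 dn.
apply: (kappa1_ge L0 P0 sP dvdP); rewrite (le_trans lP) // lerD2l.
by rewrite lef_pV2 // posrE (lt_le_trans L0).
Qed.

(** Powers multiply the order of vanishing, the degree and the logarithm of the
    sum of the moduli by r. Starting from a block of degree m whose sum is at
    most 3, this produces order about sqrt (n r) / 2 at the cost 3 ^ r. *)
Lemma kappa1_ge_pow {R : realType} (n m r d : nat) (L : R) :
  (0 < m)%N -> (4 * d ^ 2 <= m)%N -> (m * r <= n)%N -> 0 < L ->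
  3 ^+ r <= 1 + L^-1 -> (d.+1 * r <= kappa1 n L)%N.
Proof.
move=> m0 dm mrn L0 rL; have mR0 : 0 < m%:R :> R by rewrite ltr0n.
have dn : (2 * d ^ 2 < m)%N by lia.
have [P [P0 sP dvdP lP]] := @cheb_vanishing R m d m0 dn.
have dmR : 1 / 2 <= 1 - 2 * d%:R ^+ 2 / m%:R :> R.
  have : 2 * d%:R ^+ 2 / m%:R <= 1 / 2 :> R.
    rewrite ler_pdivrMr //.
    have : (4 * d%:R ^+ 2 : R) <= m%:R by rewrite -natrX -natrM ler_nat.
    by lra.
  by lra.
have lP3 : l1norm P <= 3.
  rewrite (le_trans lP) //.
  have : (1 - 2 * d%:R ^+ 2 / m%:R)^-1 <= (1 / 2)^-1 :> R.
    by rewrite lef_pV2 // posrE ?(lt_le_trans _ dmR) //; lra.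
  by rewrite div1r invrK; lra.
apply: (kappa1_ge (P := P ^+ r)) => //.
- by rewrite -!horner_coef0 horner_exp horner_coef0 P0 expr1n.
- rewrite (leq_trans (size_poly_exp_leq _ _)) // ltnS (leq_trans _ mrn) // leq_mul2r.
  by rewrite -subn1 leq_subLR add1n sP orbT.
- by rewrite exprM dvdp_exp2r.
- rewrite (le_trans (l1normX _ _)) // (le_trans _ rL) //.
  by rewrite lerXn2r // nnegrE ?sumr_ge0.
Qed.

(** Take the largest r with 3 ^ r <= 1 + 1 / L, so that r is comparable to
    - ln L, and r blocks of degree m = n / r (rounded down). When r > n the
    blocks would have degree 0, and (1 - 'X) ^ n does it. *)
Lemma kappa1_ge_small {R : realType} (n : nat) (L : R) :
  (0 < n)%N -> 0 < L -> L <= 1 / 2 ->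
  2 / 7 * Num.min (Num.sqrt (n%:R * - ln L)) n%:R <= (kappa1 n L)%:R.
Proof.
move=> n0 L0 L12.
have LV : 2 <= L^-1.
  by rewrite -[2]invrK lef_pV2 ?posrE ?invr_gt0 // -div1r.
have [r r0 [rL Lr]] : exists2 r, (0 < r)%N &
    3 ^+ r <= 1 + L^-1 /\ 1 + L^-1 < 3 ^+ r.+1.
  have ex : exists r, 1 + L^-1 < 3 ^+ r.+1.
    exists (Num.truncn (1 + L^-1)); apply: lt_le_trans (truncnS_gt _) _.
    by rewrite -natrX ler_nat ltnW // ltn_expl.
  case: (ex_minnP ex) => -[|r] Lr min_r; first by move: Lr; lra.
  exists r.+1 => //; split=> //; rewrite leNgt; apply/negP => /min_r.
  by rewrite ltnn.
have ln3 : ln 3 <= 6 / 5 :> R.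
  rewrite -[6 / 5]expRK ler_ln ?posrE ?expR_gt0 //.
  (* (1 + 3 / 20) ^ 8 already exceeds 3. *)
  have -> : 6 / 5 = 8%:R * (3 / 20) :> R by field.
  rewrite expRM_natl (@le_trans _ _ ((1 + 3 / 20) ^+ 8)) //.
    by rewrite !exprS expr0; lra.
  by rewrite lerXn2r ?nnegrE ?expR_ge0 ?expR_ge1Dx //; lra.
have lnL : - ln L <= 6 / 5 * r.+1%:R.
  rewrite -lnV ?posrE // (@le_trans _ _ (ln (3 ^+ r.+1))) //.
    rewrite ler_ln ?posrE ?exprn_gt0 ?invr_gt0 // ltW //.
    by rewrite (lt_trans _ Lr) // ltrDr.
  by rewrite lnXn // -(mulr_natr (ln 3)) ler_wpM2r.
case: (ltnP n r) => [nr|rn].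
  have : (0.+1 * n <= kappa1 n L)%N.
    apply: (@kappa1_ge_pow R n 1 n 0 L) => //; first by rewrite mul1n.
    by rewrite (le_trans _ rL) // ler_weXn2l ?(ltnW nr) // ler1n.
  rewrite mul1n -(ler_nat R); apply: le_trans.
  have : Num.min (Num.sqrt (n%:R * - ln L)) n%:R <= n%:R by rewrite ge_min lexx orbT.
  have : 0 <= n%:R :> R by [].
  by lra.
pose m := (n %/ r)%N.
have m0 : (0 < m)%N by rewrite divn_gt0.
have mrn : (m * r <= n)%N by rewrite leq_trunc_div.
have [d [dm md]] : exists d, (4 * d ^ 2 <= m)%N /\ (m < 4 * d.+1 ^ 2)%N.
  elim: (m) => [|k [d [dk kd]]]; first by exists 0%N.
  case: (ltnP k.+1 (4 * d.+1 ^ 2)) => h; first by exists d; split=> //; lia.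
  by exists d.+1; split=> //; nia.
have := kappa1_ge_pow m0 dm mrn L0 rL; rewrite -(ler_nat R); apply: le_trans.
rewrite (@le_trans _ _ (2 / 7 * Num.sqrt (n%:R * - ln L))) //.
  by rewrite ler_wpM2l ?ge_min ?lexx //; lra.
rewrite -(ler_pXn2r (ltn0Sn 1)) ?nnegrE ?mulr_ge0 ?sqrtr_ge0 //; last by lra.
have lnL0 : 0 <= - ln L by rewrite oppr_ge0 ln_le0 //; lra.
rewrite exprMn sqr_sqrtr ?mulr_ge0 //.
have nr : (n%:R : R) <= r%:R * (4 * d.+1%:R ^+ 2).
  rewrite -natrX -!natrM ler_nat; have := ltn_ceil n r0; rewrite -/m => h.
  by nia.
have r1 : 1 <= r%:R :> R by rewrite ler1n.
have lnL' : - ln L <= 12 / 5 * r%:R by move: lnL; rewrite -natr1; lra.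
have -> : (d.+1 * r)%:R ^+ 2 = (r%:R * (4 * d.+1%:R ^+ 2)) * (1 / 4 * r%:R) :> R.
  by rewrite natrM; field.
(* It remains that (2 / 7) ^ 2 * (12 / 5) <= 1 / 4. *)
rewrite mulrCA ler_pM ?mulr_ge0 ?invr_ge0 //.
by move: lnL' r1; lra.
Qed.

(** * Upper bounds for muoo *)

Lemma muoo_le {R : realType} (n k : nat) (L : R) (Q : {poly R}) :
  0 < L -> size Q = k.+1 -> 0 < `|Q.[0]| ->
  (forall j, (1 <= j <= n)%N -> `|Q.[j%:R]| < L * `|Q.[0]|) ->
  (muoo n L <= k)%N.
Proof.
move=> L0 sQ Q0 Qj; rewrite /muoo; case: ex_minnP => m _; apply.
apply/asboolP; exists (map_poly (real_complex R) Q); rewrite size_map_poly; split=> //.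
have hornerC a :
    (map_poly (real_complex R) Q).[real_complex R a] = real_complex R Q.[a].
  by rewrite horner_map.
rewrite -(rmorph0 (real_complex R)) hornerC cabs_real ltr_pdivrMl //.
rewrite big_nat; elim/big_ind: _ => [|a b a0 b0|j jn]; first by rewrite mulr_gt0.
  by rewrite gt_max a0.
by rewrite -(rmorph_nat (real_complex R)) hornerC cabs_real Qj.
Qed.

(** The Chebyshev polynomial transplanted to an interval of length n starting at
    1 is bounded by 1 there and is at least 1 + 2 k ^ 2 / n at 0. The last
    quantity exceeds 1 + 2 (1 - L), which is at least 1 / L since
    (2 L - 1) (1 - L) >= 0. *)
Lemma muoo_le_near1 {R : realType} (n k : nat) (L : R) :
  (0 < n)%N -> 1 / 2 <= L -> L <= 1 -> n%:R * (1 - L) < k%:R ^+ 2 ->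
  (muoo n L <= k)%N.
Proof.
move=> n0 L12 L1 kL; have L0 : 0 < L by lra.
have nR0 : 0 < n%:R :> R by rewrite ltr0n.
pose q : {poly R} := (1 + 2 / n%:R)%:P - (2 / n%:R) *: 'X.
have n2 : 2 / n%:R != 0 :> R by rewrite mulf_neq0 ?invr_neq0 ?pnatr_eq0 -?lt0n.
have sq : size q = 2%N.
  rewrite /q addrC size_polyDl size_polyN size_scale ?size_polyX //.
  by rewrite size_polyC; case: eqP.
have qE t : q.[t] = 1 + 2 / n%:R * (1 - t).
  by rewrite hornerD hornerN hornerZ hornerX hornerC; ring.
have T0 : 1 < L * (cheb k).[1 + 2 / n%:R].
  have y1 : 1 <= 1 + 2 / n%:R :> R by rewrite lerDl divr_ge0.
  have := cheb_ge k y1.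
  have : 2 * (1 - L) < k%:R ^+ 2 * (1 + 2 / n%:R - 1).
    have -> : k%:R ^+ 2 * (1 + 2 / n%:R - 1) = 2 * k%:R ^+ 2 / n%:R :> R by ring.
    by rewrite ltr_pdivlMr //; lra.
  by nra.
have Q0 : (cheb k \Po q).[0] = (cheb k).[1 + 2 / n%:R].
  by rewrite horner_comp qE subr0 mulr1.
have T0' : 0 < (cheb k).[1 + 2 / n%:R] :> R.
  by have := lt_trans ltr01 T0; rewrite pmulr_rgt0.
apply: (muoo_le (Q := cheb k \Po q)).
- by lra.
- by rewrite size_comp_poly2 // size_cheb.
- by rewrite Q0 normr_gt0 gt_eqF.
move=> j /andP[j1 jn]; rewrite Q0 (gtr0_norm T0') (le_lt_trans _ T0) //.
rewrite horner_comp qE cheb_le1 //.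
have : 1 <= j%:R :> R by rewrite ler1n.
have : 2 / n%:R * (j%:R - 1) <= 2 :> R.
  rewrite -mulrA ler_piMr // mulrC ler_pdivrMr // mul1r lerBlDr.
  by rewrite (le_trans (_ : _ <= n%:R)) ?ler_nat // lerDl.
have : 0 < 2 / n%:R :> R by rewrite divr_gt0.
by move=> *; apply/andP; split; nra.
Qed.

(** The zeros of the Chebyshev polynomial of degree K transplanted to [0, n],
    in increasing order and numbered from 0. *)
Definition cheb_zero {R : realType} (n K i : nat) : R :=
  n%:R * (1 - cos ((i%:R + 1 / 2) / K%:R * pi)) / 2.

Lemma cheb_factor {R : realType} (n K : nat) :
  (0 < n)%N -> (0 < K)%N ->
  exists2 a : R, a != 0 &
    forall t, (cheb K).[1 - 2 / n%:R * t] =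
      a * \prod_(i < K) (t - cheb_zero n K i).
Proof.
move=> n0 K0; have nR0 : n%:R != 0 :> R by rewrite pnatr_eq0 -lt0n.
pose q : {poly R} := 1 - (2 / n%:R) *: 'X.
have n2 : 2 / n%:R != 0 :> R by rewrite mulf_neq0 ?invr_neq0 // pnatr_eq0.
have sq : size q = 2%N.
  rewrite /q addrC size_polyDl size_polyN size_scale ?size_polyX //.
  by rewrite size_poly1.
have qE t : q.[t] = 1 - 2 / n%:R * t.
  by rewrite hornerD hornerN hornerZ hornerX hornerC.
have KR0 : 0 < K%:R :> R by rewrite ltr0n.
have sS : size (cheb K \Po q) = K.+1 by rewrite size_comp_poly2 // size_cheb.
pose rs := [seq cheb_zero n K i : R | i <- iota 0 K].
have in0pi i : (i < K)%N -> ((i%:R + 1 / 2) / K%:R * pi : R) \in `[0, pi]%R.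
  move=> iK; have : (i.+1%:R : R) <= K%:R by rewrite ler_nat.
  rewrite -natr1 => iKR; have i0 : 0 <= i%:R :> R by [].
  rewrite in_itv /= mulr_ge0 ?pi_ge0 //=; last by rewrite divr_ge0 //; lra.
  by rewrite ler_piMl ?pi_ge0 // ler_pdivrMr //; lra.
have Urs : uniq rs.
  rewrite map_inj_in_uniq ?iota_uniq // => i j.
  rewrite !mem_iota !add0n /= => iK jK; rewrite /cheb_zero => uij.
  have /(cos_inj (in0pi i iK) (in0pi j jK)) :
      cos ((i%:R + 1 / 2) / K%:R * pi) = cos ((j%:R + 1 / 2) / K%:R * pi) :> R.
    have : n%:R * (cos ((i%:R + 1 / 2) / K%:R * pi) -
                   cos ((j%:R + 1 / 2) / K%:R * pi)) = 0 :> R by move: uij; lra.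
    by move/eqP; rewrite mulf_eq0 (negPf nR0) subr_eq0 => /eqP.
  have piK : pi / K%:R != 0 :> R by rewrite mulf_neq0 ?gt_eqF ?pi_gt0 ?invr_gt0.
  rewrite !(mulrAC _ _ pi) -!mulrA => /(mulIf piK)/addIr/eqP.
  by rewrite eqr_nat => /eqP.
have rt : all (root (cheb K \Po q)) rs.
  apply/allP => _ /mapP[i _ ->]; apply/rootP; rewrite horner_comp qE.
  have -> : 1 - 2 / n%:R * cheb_zero n K i = cos ((i%:R + 1 / 2) / K%:R * pi) :> R.
    by rewrite /cheb_zero; field.
  rewrite cheb_cos mulrA mulrCA divff ?gt_eqF // mulr1 mulrDl -mulrA mul1r.
  rewrite [2^-1 * _]mulrC cosDpihalf.
  elim: (i) => [|j IHj]; first by rewrite mul0r sin0 oppr0.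
  by rewrite -natr1 mulrDl mul1r sinDpi IHj oppr0.
have := all_roots_prod_XsubC _ rt; rewrite size_map size_iota uniq_rootsE.
move=> /(_ sS Urs) fact; exists (lead_coef (cheb K \Po q)).
  by rewrite lead_coef_eq0 -size_poly_eq0 sS.
move=> t; rewrite -qE -horner_comp {1}fact hornerZ; congr (_ * _).
rewrite big_map horner_prod -[X in iota 0 X]subn0 -/(index_iota 0 K) big_mkord.
by apply: eq_bigr => i _; rewrite hornerXsubC.
Qed.

(** Let W have the zeros u_i of the Chebyshev polynomial of [0, n], so that |W|
    is maximal on [0, n] at 0. Replacing the first m zeros u_0, ..., u_(m-1) by the
    integers 1, ..., m kills the values at 1, ..., m. At an integer j > m each
    replacement changes the quotient of the moduli at j and at 0 by the factor
    (j - (i + 1)) u_i / ((j - u_i) (i + 1)). As u_i is at most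
    4 n (i + 1) ^ 2 / K ^ 2, it is at most (i + 1) / 2 when K ^ 2 >= 8 n m, and
    then the factor is at most 1 / 2. Altogether the gain is 2 ^ m, with K only
    of order sqrt (n m). *)
Lemma muoo_le_small {R : realType} (n m K : nat) (L : R) :
  (0 < n)%N -> (m <= K)%N -> (0 < K)%N -> (8 * n * m <= K ^ 2)%N ->
  0 < L -> 2 ^- m < L -> (muoo n L <= K)%N.
Proof.
move=> n0 mK K0 nmK L0 mL.
have nR0 : 0 < n%:R :> R by rewrite ltr0n.
have KR0 : 0 < K%:R :> R by rewrite ltr0n.
pose u i : R := cheb_zero n K i.
have [a a0 fact] := @cheb_factor R n K n0 K0.
pose W t := \prod_(i < K) (t - u i).
have W_le t : 0 <= t <= n%:R -> `|W t| <= `|W 0|.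
  move=> /andP[t0 tn]; rewrite -(ler_pM2l (_ : 0 < `|a|)) ?normr_gt0 //.
  rewrite -!normrM -!fact mulr0 subr0.
  have -> : (cheb K).[1] = 1 :> R by rewrite -cos0 cheb_cos mulr0.
  rewrite normr1 cheb_le1 //.
  have -> : 2 / n%:R * t = 2 * (t / n%:R) by ring.
  have : 0 <= t / n%:R by rewrite divr_ge0.
  have : t / n%:R <= 1 by rewrite ler_pdivrMr // mul1r.
  by move=> *; apply/andP; split; lra.
have W0 : 0 < `|W 0|.
  rewrite normr_gt0; apply: contra_neq (oner_neq0 R) => W0.
  by rewrite -[RHS](mulr0 a) -W0 -fact mulr0 subr0 -cos0 cheb_cos mulr0.
have u_ge0 i : 0 <= u i.
  by rewrite /u /cheb_zero divr_ge0 // mulr_ge0 // subr_ge0 cos_le1.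
have u_le i : (i < m)%N -> u i <= i.+1%:R / 2.
  move=> im; have i0 : 0 <= i%:R :> R by [].
  have pi4 : pi <= 4 :> R by have := @pihalf_lt2 R; lra.
  pose theta : R := (i%:R + 1 / 2) / K%:R * pi.
  have th0 : 0 <= theta by rewrite mulr_ge0 ?pi_ge0 // divr_ge0 //; lra.
  have th1 : theta <= 4 * (i.+1%:R / K%:R).
    rewrite /theta mulrC ler_pM ?pi_ge0 ?divr_ge0 //; first by lra.
    by rewrite ler_pM2r ?invr_gt0 // -(natr1 i); lra.
  have := one_sub_cos_le th0.
  have th2 : theta ^+ 2 <= (4 * (i.+1%:R / K%:R)) ^+ 2.
    by rewrite lerXn2r // nnegrE mulr_ge0 // divr_ge0.
  have key : n%:R * (i.+1%:R / K%:R) ^+ 2 <= i.+1%:R / 8 :> R.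
    rewrite expr_div_n mulrA ler_pdivrMr ?exprn_gt0 // expr2.
    have : (8 * n%:R * i.+1%:R : R) <= K%:R ^+ 2.
      rewrite -natrX -!natrM ler_nat (leq_trans _ nmK) //.
      by rewrite leq_mul2l im orbT.
    have : 0 <= i.+1%:R :> R by [].
    by nra.
  move: th2; rewrite exprMn /u /cheb_zero -/theta => th2 cth.
  have : n%:R * (1 - cos theta) <= n%:R * (4 ^+ 2 * (i.+1%:R / K%:R) ^+ 2 / 2).
    by rewrite ler_pM2l //; move: th2 cth; lra.
  by move: key; lra.
(* Indices start at 0: the i-th zero is moved to the integer i + 1. *)
pose z i : R := if (i < m)%N then i.+1%:R else u i.
pose Q : {poly R} := \prod_(i < K) ('X - (z i)%:P).
have QE t : Q.[t] = \prod_(i < K) (t - z i).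
  by rewrite horner_prod; apply: eq_bigr => i _; rewrite hornerXsubC.
have u_neq0 (i : 'I_K) : u i != 0.
  apply: contraTneq W0 => ui; rewrite /W (bigD1 i) //= ui subrr mul0r.
  by rewrite normr0 ltxx.
have Q0 : 0 < `|Q.[0]|.
  rewrite normr_gt0 QE; apply/prodf_neq0 => i _; rewrite sub0r oppr_eq0 /z.
  by case: ifP => _; rewrite ?pnatr_eq0.
apply: (muoo_le (Q := Q)) => //.
  by rewrite /Q size_prod_XsubC /index_enum -enumT size_enum_ord.
move=> j /andP[j1 jn]; rewrite (@le_lt_trans _ _ (2 ^- m * `|Q.[0]|)) ?ltr_pM2r //.
case: (leqP j m) => [jm|mj].
  have jK : (j.-1 < K)%N by rewrite prednK // (leq_trans jm).
  rewrite QE (bigD1 (Ordinal jK)) //= /z prednK // jm subrr mul0r normr0.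
  by rewrite mulr_ge0 // invr_ge0 exprn_ge0.
rewrite -(ler_pM2r W0) -mulrA [`|Q.[0]| * _]mulrC.
rewrite (@le_trans _ _ (2 ^- m * (`|W j%:R| * `|Q.[0]|))) //; last first.
  by rewrite ler_pM2l ?invr_gt0 ?exprn_gt0 // ler_pM2r // W_le // ler0n ler_nat.
have -> : 2 ^- m = \prod_(i < K) (2^-1) ^+ (i < m)%N :> R.
  rewrite prodrXr exprVn; congr (_ ^- _).
  rewrite -[LHS]card_ord -sum1_card (big_ord_widen K (fun=> 1%N) mK) big_mkcond.
  by apply: eq_bigr => i _; case: (i < m)%N.
rewrite /W !QE !normr_prod -!big_split /=; apply: ler_prod => i _.
rewrite mulr_ge0 //= /z !sub0r !normrN; case: ifP => im.
  have := u_le i im; have := u_ge0 i => ui0 ui.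
  have ij : (i.+1%:R : R) <= j%:R by rewrite ler_nat (leq_trans im) // ltnW.
  have i0 : 0 <= i.+1%:R :> R by [].
  rewrite expr1 !ger0_norm //; try lra.
  by nra.
by rewrite expr0 mul1r mulrC.
Qed.

Lemma muoo_le_n {R : realType} (n : nat) (L : R) : 0 < L -> (muoo n L <= n)%N.
Proof.
move=> L0; pose Q : {poly R} := \prod_(i < n) ('X - (i.+1%:R)%:P).
have QE t : Q.[t] = \prod_(i < n) (t - i.+1%:R).
  by rewrite horner_prod; apply: eq_bigr => i _; rewrite hornerXsubC.
have Q0 : 0 < `|Q.[0]|.
  rewrite normr_gt0 QE; apply/prodf_neq0 => i _.
  by rewrite sub0r oppr_eq0 pnatr_eq0.
apply: (muoo_le (Q := Q)) => //.
  by rewrite /Q size_prod_XsubC /index_enum -enumT size_enum_ord.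
case=> [|j] // /andP[_ jn]; rewrite QE (bigD1 (Ordinal jn)) //= subrr mul0r normr0.
by rewrite mulr_gt0.
Qed.

(** Choose the least m with 2 ^ (- m) < L, which is at most 4 (- ln L), and the
    least degree with square at least 8 n m, which is at most
    6 sqrt (n (- ln L)) + 1. If that degree is n or more, the polynomial with
    zeros 1, ..., n serves instead. *)
Lemma muoo_le_sqrt {R : realType} (n : nat) (L : R) :
  (0 < n)%N -> 0 < L -> L <= 1 / 2 ->
  (muoo n L)%:R <= 13 * Num.min (Num.sqrt (n%:R * - ln L)) n%:R + 4.
Proof.
move=> n0 L0 L12; have nR0 : 0 < n%:R :> R by rewrite ltr0n.
have ln2 : 1 / 2 <= ln 2 :> R.
  rewrite -[1 / 2]expRK ler_ln ?posrE ?expR_gt0 //.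
  have := expR_ge1Dx (- (1 / 2) : R); rewrite expRN => h.
  rewrite -[leRHS]invrK -[leLHS]invrK lef_pV2 ?posrE ?invr_gt0 ?expR_gt0 //; lra.
set A := Num.sqrt (n%:R * - ln L).
have A0 : 0 <= A by rewrite sqrtr_ge0.
have lnL : ln 2 <= - ln L.
  rewrite -lnV ?posrE // ler_ln ?posrE ?invr_gt0 //.
  by rewrite -[2]invrK lef_pV2 ?posrE ?invr_gt0 // -div1r.
have A2 : A ^+ 2 = n%:R * - ln L.
  by rewrite sqr_sqrtr // mulr_ge0 //; lra.
have [m mL Lm] : exists2 m : nat, 2 ^- m < L & m%:R <= 4 * - ln L.
  have ex : exists m, 2 ^- m < L.
    exists (Num.truncn L^-1).
    rewrite -[ltRHS]invrK ltf_pV2 ?posrE ?invr_gt0 ?exprn_gt0 //.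
    apply: lt_le_trans (truncnS_gt _) _; rewrite -natrX ler_nat.
    exact: ltn_expl.
  case: (ex_minnP ex) => -[|m] mL min_m; first by move: mL; rewrite invr1; lra.
  exists m.+1 => //.
  have Lm : L <= 2 ^- m by rewrite leNgt; apply/negP => /min_m; rewrite ltnn.
  have : m%:R * ln 2 <= - ln L.
    rewrite mulr_natl -lnXn // lerNr -lnV ?posrE ?exprn_gt0 //.
    by rewrite ler_ln ?posrE ?invr_gt0 ?exprn_gt0.
  have : 0 <= m%:R :> R by [].
  by rewrite -natr1; nra.
have m0 : (0 < m)%N.
  by case: (m) mL => // ; rewrite invr1; lra.
(* The degree used is K + 1, so that K itself is bounded from above. *)
have [K K2 K1] : exists2 K, (8 * n * m <= K.+1 ^ 2)%N & (K ^ 2 < 8 * n * m)%N.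
  have ex : exists K, (8 * n * m <= K ^ 2)%N.
    by exists (8 * n * m)%N; rewrite -mulnn; nia.
  case: (ex_minnP ex) => -[|K] h min_K; first by nia.
  by exists K => //; rewrite ltnNge; apply/negP => /min_K; rewrite ltnn.
have KA : K%:R <= 6 * A.
  rewrite -(ler_pXn2r (ltn0Sn 1)) ?nnegrE ?mulr_ge0 // exprMn A2 -natrX.
  rewrite (@le_trans _ _ (8 * n * m)%:R) ?ler_nat 1?ltnW // !natrM.
  have : n%:R * m%:R <= n%:R * (4 * - ln L) by rewrite ler_pM2l.
  have : 0 <= n%:R * - ln L by rewrite -A2 sqr_ge0.
  by lra.
have [nK|Kn] := leqP n K.+1.
  have : (muoo n L)%:R <= n%:R :> R by rewrite ler_nat muoo_le_n.
  have : n%:R <= K%:R + 1 :> R by rewrite natr1 ler_nat.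
  by rewrite minEle; case: ifP => _; lra.
have : (muoo n L)%:R <= K.+1%:R :> R.
  by rewrite ler_nat (@muoo_le_small _ n m) //; nia.
have : K%:R + 1 <= n%:R :> R by rewrite natr1 ler_nat ltnW.
by rewrite -natr1 minEle; case: ifP => _; lra.
Qed.

Theorem theorem2p2 (R : realType) :
  exists c1 c2 c3 c4 : R,
    [/\ c1 = 1 / 5, c2 = 1, c3 = 2 / 7 & c4 = 13] /\
    [/\ 0 < c1, 0 < c2, 0 < c3 & 0 < c4] /\
    (forall (n : nat) (L : R), (1 <= n)%N -> 1 / 2 < L -> L <= 1 ->
       [/\ c1 * Num.sqrt (n%:R * (1 - L)) - 1 <= (kappa1 n L)%:R,
           (kappa1 n L <= muoo n L)%N
         & (muoo n L)%:R <= c2 * Num.sqrt (n%:R * (1 - L)) + 1]) /\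
    (forall (n : nat) (L : R), (1 <= n)%N -> 0 < L -> L <= 1 / 2 ->
       [/\ c3 * Num.min (Num.sqrt (n%:R * - ln L)) n%:R <= (kappa1 n L)%:R,
           (kappa1 n L <= muoo n L)%N
         & (muoo n L)%:R <=
             c4 * Num.min (Num.sqrt (n%:R * - ln L)) n%:R + 4]) /\
    (forall (n : nat) (L : R), (1 <= n)%N -> 1 < L ->
       kappa1 n L = 0%N /\ muoo n L = 0%N).
Proof.
exists (1 / 5), 1, (2 / 7), 13; split; first by [].
split; first by split; lra.
split; [|split] => n L n0.
- move=> L12 L1; have L0 : 0 < L by lra.
  have nR0 : 0 < n%:R :> R by rewrite ltr0n.
  set s := Num.sqrt _; have s0 : 0 <= s by rewrite sqrtr_ge0.
  have s2 : s ^+ 2 = n%:R * (1 - L) by rewrite sqr_sqrtr // mulr_ge0 //; lra.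
  split; last 1 first.
  + have /andP[ks sk] := truncn_itv s0.
    have : (muoo n L <= (Num.truncn s).+1)%N.
      apply: muoo_le_near1 => //; first by lra.
      by rewrite -s2 ltr_pXn2r ?nnegrE.
    by rewrite -(ler_nat R) -natr1 mul1r => h; apply: (le_trans h); rewrite lerD2r.
  + have s50 : 0 <= 1 / 5 * s by lra.
    have /andP[ds sd] := truncn_itv s50; set d := Num.truncn _ in ds sd.
    have : (d.+1 <= kappa1 n L)%N.
      apply: kappa1_ge_near1 => //.
      have : d%:R ^+ 2 / n%:R <= 1 / 25 * (1 - L).
        rewrite ler_pdivrMr //.
        have -> : 1 / 25 * (1 - L) * n%:R = (1 / 5 * s) ^+ 2.
          by rewrite exprMn s2; field.
        by rewrite lerXn2r ?nnegrE.
      by rewrite -mulrA; lra.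
    by rewrite -(ler_nat R) => h; move: (le_trans (ltW sd) h); lra.
  + exact: kappa1_le_muoo.
- move=> L0 L12; split; first exact: kappa1_ge_small.
    exact: kappa1_le_muoo.
  exact: muoo_le_sqrt.
- move=> L1; have L0 : 0 < L by lra.
  suff mu0 : muoo n L = 0%N.
    by split=> //; apply/eqP; rewrite -leqn0 -mu0 kappa1_le_muoo.
  apply/eqP; rewrite -leqn0; apply: (muoo_le (Q := 1)) => //.
  + by rewrite size_poly1.
  + by rewrite hornerC normr1.
  + by move=> j _; rewrite !hornerC normr1 mulr1.
Qed.
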